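(* Let $q$ be a prime power and $\ell$ a prime with $\ell\nmid q$. Let $P(x)\in\mathbb{Z}_\ell[x]$ be monic with $\ell\nmid P(0)$, and let $\mathcal{E}$ and the probability measures $\mu_g$ on $\mathcal{E}$ be as in the context. Fix $(H,F_H,\omega_H)\in\mathcal{E}$. There is an integer $g_0$, depending only on $(H,\omega_H)$, with the following property. Consider the $\mu_g$-expected number of surjective homomorphisms $T:G\twoheadrightarrow H$ satisfying $T\circ F_G=F_H\circ T$ and $(\wedge^2T)(\omega_G)=\omega_H$, where $(G,F_G,\omega_G)$ is $\mu_g$-random. This expected number is $0$ for $g\leq g_0$ and $1$ for all $g>g_0$.
   Context: $\mathcal{E}$ is the set of isomorphism classes of triples $(G,F_G,\omega_G)$ with the following properties: $G$ is a finite abelian $\ell$-group; $\omega_G\in\wedge^2G$; $F_G$ is an endomorphism of $G$ with $P(F_G)=0$ and $(\wedge^2F_G)(\omega_G)=q\,\omega_G$. Let $\omega=\sum_{i=1}^g e_i\wedge e_{g+i}\in\wedge^2\mathbb{Z}_\ell^{2g}$. Let $\mathrm{GSp}^{(q)}_{2g}(\mathbb{Z}_\ell)$ be the coset of $\mathrm{Sp}(\mathbb{Z}_\ell^{2g},\omega)$ in $\mathrm{GSp}_{2g}(\mathbb{Z}_\ell)$ of elements scaling the symplectic structure by $q$, i.e. $F\in\mathrm{GL}_{2g}(\mathbb{Z}_\ell)$ with $(\wedge^2F)(\omega)=q\omega$. The measure $\mu_g$ is the pushforward of the Haar probability measure on this coset under $F\mapsto(\mathrm{Coker}\,P(F),\overline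 F,\overline\omega)$. Here $\overline F$ is the endomorphism induced on $\mathrm{Coker}\,P(F)$ and $\overline\omega$ is the image of $\omega$ in $\wedge^2\mathrm{Coker}\,P(F)$. *)

(* Defs.v *)
From HB Require Import structures.
From mathcomp Require Import all_boot all_order all_algebra.
From mathcomp Require Import all_classical all_reals all_analysis.
Unset Printing Implicit Defensive.
Import Order.TTheory GRing.Theory Num.Theory.
Local Open Scope ring_scope.
Local Open Scope classical_set_scope.

(** * l-adic integers as compatible systems of residues.
    An element x of Z_l is represented by the sequence (x k)_k of its
    residues modulo l^(k+1), each taken in [0, l^(k+1)). *)
Definition red (l k : nat) (a : int) : int := (a %% (l ^ k.+1)%N%:Z)%Z.

Definition zl_poly (l : nat) (P : nat -> {poly int}) : Prop :=
  forall k, P k = map_poly (red l k) (P k.+1).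

Definition zl_mx (l : nat) {n : nat} (F : nat -> 'M[int]_n) : Prop :=
  forall k, F k = map_mx (red l k) (F k.+1).

(** Gram matrix of omega = sum_i e_i /\ e_{g+i}  (basis 'I_(g+g), e_{g+i} = rshift) *)
Definition Jmx (g : nat) : 'M[int]_(g + g) := block_mx 0 1%:M (- 1%:M) 0.

Definition mxpow {n} (A : 'M[int]_n) (i : nat) : 'M[int]_n := iter i (mulmx A) 1%:M.
Definition mxhorner {n} (p : {poly int}) (A : 'M[int]_n) : 'M[int]_n :=
  \sum_(i < size p) p`_i *: mxpow A i.

Notation Mseq n := (nat -> 'M[int]_n).
HB.instance Definition _ := isPointed.Build int 0%R.

Definition lvl_mul (l : nat) {n : nat} (A B : Mseq n) : Mseq n :=
  fun k => map_mx (red l k) (A k *m B k).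

(** GSp^{(q)}_{2g}(Z_l): F in GL_{2g}(Z_l) with (wedge^2 F)(omega) = q omega, i.e.
    F J F^T = q J (wedge^2 Z_l^{2g} identified with alternating matrices). *)
Definition gsp_coset (l q g : nat) : set (Mseq (g + g)) :=
  [set F | [/\ zl_mx l F, ~~ ((l%:Z %| \det (F 0%N))%Z) &
     forall k, map_mx (red l k) (F k *m Jmx g *m (F k)^T)
             = map_mx (red l k) (q%:Z *: Jmx g)]].

Definition sp_group (l g : nat) : set (Mseq (g + g)) := gsp_coset l 1 g.

(** cylinder sets; they generate the (Borel) sigma-algebra of the profinite topology *)
Definition cyl (n : nat) : set (set (Mseq n)) :=
  [set A | exists (k : nat) (M : 'M[int]_n), A = [set F | F k = M]].

Notation MseqM n := (g_sigma_algebraType (@cyl n)).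

Definition haar_gsp (l q g : nat) {R : realType}
    (mu : probability (MseqM (g + g)) R) : Prop :=
  mu (gsp_coset l q g) = 1%E /\
  forall s, sp_group l g s ->
    forall A : set (MseqM (g + g)), measurable A ->
      mu ((lvl_mul l s : MseqM (g + g) -> MseqM (g + g)) @^-1` A) = mu A.

(** * Second exterior power of a finite abelian group H:
    the free abelian group Z[H x H] (finitely supported = all functions, H finite)
    modulo bilinearity and alternation relations.  [wdelta a b] is a /\ b. *)
Definition wdelta {H : finZmodType} (a b : H) : {ffun H * H -> int} :=
  [ffun x => (x == (a, b))%:Z].

Definition wedge_rel {H : finZmodType} (w : {ffun H * H -> int}) : Prop :=
  exists (cl cr : {ffun H * H * H -> int}) (ca : {ffun H -> int}),
    w = \sum_t (wdelta (t.1.1 + t.1.2) t.2 - wdelta t.1.1 t.2 - wdelta t.1.2 t.2) *~ cl t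
      + \sum_t (wdelta t.1.1 (t.1.2 + t.2) - wdelta t.1.1 t.1.2 - wdelta t.1.1 t.2) *~ cr t
      + \sum_a wdelta a a *~ ca a.

Definition wedge_eq {H : finZmodType} (w1 w2 : {ffun H * H -> int}) : Prop :=
  wedge_rel (w1 - w2).

Definition wedge_map {H H' : finZmodType} (f : H -> H') (w : {ffun H * H -> int})
  : {ffun H' * H' -> int} := \sum_p wdelta (f p.1) (f p.2) *~ w p.

(** Z_l acts on the finite l-group H through Z/l^(#|H|+1) (which kills H). *)
Definition poly_kills (l : nat) {H : finZmodType} (P : nat -> {poly int}) (f : H -> H) : Prop :=
  forall h : H, \sum_(i < size (P #|H|)) (iter i f h *~ (P #|H|)`_i) = 0.

Definition prime_power (q : nat) : Prop := exists p e, [/\ prime p, (0 < e)%N & q = (p ^ e)%N].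

(** Surjective homomorphisms T : Coker P(F) ->> H with T F_G = F_H T and
    (wedge^2 T)(omega_G) = omega_H correspond (via the quotient map
    Z_l^{2g} ->> Coker P(F)) to tuples h = (T(e_i))_i in H^{2g} such that
    - the induced map Z_l^{2g} -> H, x |-> sum x_i h_i kills the columns of P(F),
    - it is surjective,
    - it intertwines F and F_H,
    - sum_i h_i /\ h_{g+i} = omega_H in wedge^2 H. *)
Definition good_tuple (l g : nat) {H : finZmodType} (P : nat -> {poly int}) (FH : H -> H)
    (wH : {ffun H * H -> int}) (F : Mseq (g + g)) (h : {ffun 'I_(g + g) -> H}) : Prop :=
  let K := #|H| in
  let PF := map_mx (red l K) (mxhorner (P K) (F K)) in
  [/\ forall j, \sum_i h i *~ PF i j = 0,
      forall y : H, exists a : 'I_(g + g) -> int, y = \sum_i h i *~ a i,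
      forall j, \sum_i h i *~ F K i j = FH (h j) &
      wedge_eq (\sum_(i < g) wdelta (h (lshift g i)) (h (rshift g i))) wH].

Definition count_surj (l g : nat) {H : finZmodType} (P : nat -> {poly int}) (FH : H -> H)
    (wH : {ffun H * H -> int}) (F : Mseq (g + g)) : nat :=
  #|[set h : {ffun 'I_(g + g) -> H} | `[< good_tuple l g P FH wH F h >] ]|.

(* Main.v *)
Require Import Defs.
From HB Require Import structures.
From mathcomp Require Import all_boot all_order all_algebra.
From mathcomp Require Import all_classical all_reals all_analysis.
From mathcomp Require Import generic_quotient ring_quotient.
From mathcomp Require Import ring zify.
Import Order.TTheory GRing.Theory Num.Theory.
Local Open Scope quotient_scope.
Local Open Scope ring_scope.
Local Open Scope classical_set_scope.
Set Implicit Arguments.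
Unset Strict Implicit.

(** If a surjection [h : Z_l^(2g) ->> H] carries [omega] to [omega_H] then so do
    all [h S] with [S] symplectic, and by Haar invariance the law of [h F] is
    unchanged when [h] is replaced by [h S].  The symplectic group acts
    transitively on the set [X] of these surjections, so
    [Pr(h F = F_H h) = Pr(h0 F = F_H h)] for a fixed [h0] in [X].  As [F_H] maps
    [X] bijectively onto the surjections carrying [omega] to [q omega_H], and
    [h0 F] always is such a surjection, these probabilities sum to [1] as soon
    as [X] is nonempty.  Nonemptiness is monotone in [g], by padding with zeros.

    Transitivity is reached one cyclic step at a time.  Given [h] and [h'] in [X]
    that agree modulo [D + Z c], where [c = l^(e-1) x] and [l^e] is the exponent
    of [H / D], write [h' = h + <v, .> c] modulo [D]; then [c /\ h(v) = 0] in the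
    exterior square of [H / D], which forces [l^(e-1) h(v)] to be a multiple of
    [c], and one or two transvections carry [h] to [h'] modulo [D].  These
    transvections have integer entries, so each of them is an element of
    [Sp(Z_l)]. *)

(** * Characters of finite abelian groups *)

(** Additivity is assumed on the subgroup [M] only: a partial character is coded as a total function
    whose values off [M] are arbitrary. *)
Lemma morph_in_Mz (U V : zmodType) (M : {pred U}) (f : U -> V) :
  zmod_closed M -> {in M &, {morph f : x y / x - y}} ->
  [/\ f 0 = 0, {in M, forall y (b : int), y *~ b \in M} &
      {in M, forall y (b : int), f (y *~ b) = f y *~ b}].
Proof.
move=> [M0 MB] fB.
have f0 : f 0 = 0 by rewrite -(subrr (0 : U)) fB // subrr.
have MN y : y \in M -> - y \in M by move=> My; rewrite -sub0r; exact: MB.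
have fN y : y \in M -> f (- y) = - f y.
  by move=> My; rewrite -sub0r fB // f0 sub0r.
have Mn y n : y \in M -> y *+ n \in M.
  move=> My; elim: n => [//|n IH]; rewrite mulrS -[y *+ n]opprK.
  by apply: MB => //; exact: MN.
have fn y n : y \in M -> f (y *+ n) = f y *+ n.
  move=> My; elim: n => [//|n IH].
  by rewrite !mulrS -{1}[y *+ n]opprK fB ?fN ?opprK ?IH //; do ?apply: MN; exact: Mn.
split=> // y My [n|n].
- by rewrite -pmulrn; exact: Mn.
- by rewrite NegzE mulrNz -pmulrn; exact/MN/Mn.
- by rewrite -!pmulrn; exact: fn.
- by rewrite NegzE !mulrNz -!pmulrn fN ?fn //; exact: Mn.
Qed.

Lemma zmod_closed_Mz (U : zmodType) (M : {pred U}) (y : U) (b : int) :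
  zmod_closed M -> y \in M -> y *~ b \in M.
Proof.
move=> HM; have [|_ MM _] := @morph_in_Mz U U M id HM; first by move=> ? ?.
by move=> My; exact: MM.
Qed.

Definition adjoin {U : finZmodType} (M : {set U}) (x : U) : {set U} :=
  finset (fun y => `[< exists a : int, y - x *~ a \in M >]).

Lemma adjoinP (U : finZmodType) (M : {set U}) (x y : U) :
  reflect (exists a : int, y - x *~ a \in M) (y \in adjoin M x).
Proof. by rewrite /adjoin finset.inE; exact: asboolP. Qed.

Lemma adjoin_closed (U : finZmodType) (M : {set U}) (x : U) :
  zmod_closed M ->
  [/\ zmod_closed (adjoin M x), M \subset adjoin M x & x \in adjoin M x].
Proof.
move=> HM; have [M0 MB] := HM; split.
- split; first by apply/adjoinP; exists 0; rewrite mulr0z subr0.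
  move=> y z /adjoinP[a ya] /adjoinP[b zb]; apply/adjoinP.
  exists (a - b); rewrite mulrzBr.
  suff -> : y - z - (x *~ a - x *~ b) = (y - x *~ a) - (z - x *~ b) by exact: MB.
  by rewrite !opprB addrACA [RHS]addrACA [- z - _]addrC.
- by apply/fintype.subsetP => y My; apply/adjoinP; exists 0; rewrite subr0.
- by apply/adjoinP; exists 1; rewrite subrr.
Qed.

(** The extension sends [m + a x] to [chi m + a t]. The last hypothesis says that this value does
    not depend on the chosen [a]. *)
Lemma extend_adjoin (U : finZmodType) (V : zmodType) (M : {set U}) (chi : U -> V)
    (x : U) (t : V) :
  zmod_closed M -> {in M &, {morph chi : y z / y - z}} ->
  (forall a : int, x *~ a \in M -> chi (x *~ a) = t *~ a) ->
  exists chi' : U -> V,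
    [/\ {in adjoin M x &, {morph chi' : y z / y - z}},
        {in M, chi' =1 chi} & chi' x = t].
Proof.
move=> HM chiB chix; have [M0 MB] := HM.
(* A chosen coefficient of [x] in [y]; the default 0 occurs only for [y] outside [adjoin M x]. *)
pose co y : int := xget 0 [set a : int | y - x *~ a \in M].
pose chi' y := chi (y - x *~ co y) + t *~ co y.
have coP y : y \in adjoin M x -> y - x *~ co y \in M.
  by move=> /adjoinP[a ya]; rewrite /co; case: xgetP => [b -> //|/(_ a)].
have chi'E y a : y - x *~ a \in M -> chi' y = chi (y - x *~ a) + t *~ a.
  move=> ya.
  have yc : y - x *~ co y \in M.
    by apply: coP; apply/adjoinP; exists a.
  have E : x *~ (co y - a) = (y - x *~ a) - (y - x *~ co y).
    by rewrite opprB [RHS]addrC addrA subrK mulrzBr.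
  have xM : x *~ (co y - a) \in M by rewrite E; exact: MB.
  have := chix _ xM; rewrite {1}E chiB // mulrzBr /chi' => /eqP.
  rewrite subr_eq => /eqP ->.
  by rewrite addrAC subrK addrC.
exists chi'; split.
- move=> y z yA zA.
  have [HA _ _] := adjoin_closed x HM.
  have E : (y - z) - x *~ (co y - co z) = (y - x *~ co y) - (z - x *~ co z).
    by rewrite mulrzBr !opprB addrACA [RHS]addrACA [- z - _]addrC.
  have yzM : (y - z) - x *~ (co y - co z) \in M by rewrite E; apply: MB; exact: coP.
  rewrite (chi'E _ (co y - co z) yzM) E chiB ?coP // /chi' mulrzBr opprD.
  by rewrite addrACA.
- by move=> y My; rewrite (chi'E y 0) ?mulr0z ?subr0 ?addr0.
- have [chi0 _ _] := morph_in_Mz HM chiB.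
  by rewrite (chi'E x 1) ?mulr1z ?subrr // chi0 add0r.
Qed.

(** The integers [a] with [a x] in [M] form an ideal containing [N]. Its least positive element [m]
    generates it, by Euclidean division. *)
Lemma rel_order (U : zmodType) (M : {pred U}) (x : U) (N : nat) :
  zmod_closed M -> (0 < N)%N -> x *+ N \in M ->
  exists m : nat, [/\ (0 < m)%N, (m %| N)%N, x *+ m \in M &
    forall a : int, x *~ a \in M -> (m%:Z %| a)%Z].
Proof.
move=> HM N0 xN; have [M0 MB] := HM.
have exm : exists m, (0 < m)%N && (x *+ m \in M) by exists N; rewrite N0.
case: (ex_minnP exm) => m /andP[m0 xm] mmin.
have dv (a : int) : x *~ a \in M -> (m%:Z %| a)%Z.
  move=> xa; apply/dvdz_mod0P.
  have m0' : m%:Z != 0 by rewrite -lt0n in m0 *; lia.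
  have r0 := modz_ge0 a m0'.
  have r1 := ltz_pmod a (_ : 0 < m%:Z).
  have xr : x *~ (a %% m)%Z \in M.
    rewrite /modz mulrzBr; apply: MB => //; rewrite [(_ * _)%R]mulrC mulrzA.
    by apply: zmod_closed_Mz.
  case E : (a %% m)%Z r0 r1 xr => [[|k]|k] // _ r1 xr.
  have := mmin k.+1; rewrite -pmulrn in xr; rewrite xr /= => /(_ isT).
  by have := r1 m0; lia.
exists m; split=> //.
by have := dv N; rewrite -pmulrn => /(_ xN).
Qed.

(* Divisibility of the values of [chi] is what makes [chi] extend to one more
   generator [x] of order [m] modulo [M]. *)
Lemma extend_one (N : nat) (U : finZmodType) (K M : {set U}) (chi : U -> 'Z_N) (x : U) :
  (1 < N)%N -> zmod_closed M -> {in M &, {morph chi : y z / y - z}} ->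
  {in K, forall k, chi k = 0} -> x *+ N \in K -> K \subset M ->
  exists chi' : U -> 'Z_N,
    {in adjoin M x &, {morph chi' : y z / y - z}} /\ {in M, chi' =1 chi}.
Proof.
move=> N1 HM chiB chiK xNK KM.
have xNM := fintype.subsetP KM _ xNK.
have [m [m0 mN xm mdv]] := rel_order HM (ltnW N1) xNM.
have [chi0 _ chiM] := morph_in_Mz HM chiB.
pose r := chi (x *+ m).
(* Since [N x] lies in [K], [r] is killed by [N / m]; hence [m] divides the residue [r], and [r / m]
   can serve as the value at [x]. *)
have mr : (m %| r)%N.
  have : r *+ (N %/ m) = 0.
    by rewrite pmulrn -chiM // -pmulrn -mulrnA mulnC divnK // chiK.
  rewrite -mulr_natr -[r]natr_Zp -natrM => /(congr1 val).
  rewrite /= val_Zp_nat // => /eqP; rewrite -/(_ %| _)%N.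
  move=> Nr; rewrite -(@dvdn_pmul2r (N %/ m)).
    by rewrite [X in (X %| _)%N]mulnC divnK // natr_Zp.
  by rewrite divn_gt0 // dvdn_leq // ltnW.
have [|chi' [A B _]] := @extend_adjoin U _ M chi x ((r %/ m)%N%:R) HM chiB.
  move=> a xa; have /dvdzP[b ->] := mdv _ xa.
  rewrite mulrC mulrzA -pmulrn chiM // mulrzA; congr (_ *~ _).
  by rewrite -pmulrn -mulrnA divnK // natr_Zp.
by exists chi'.
Qed.

(** Z/N is injective among groups of exponent dividing [N], here applied to [U / K]; generators are
    adjoined until [M] is all of [U]. *)
Lemma extend_total (N : nat) (U : finZmodType) (K M : {set U}) (chi : U -> 'Z_N) :
  (1 < N)%N -> zmod_closed M -> {in M &, {morph chi : y z / y - z}} ->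
  {in K, forall k, chi k = 0} -> (forall x, x *+ N \in K) -> K \subset M ->
  exists chi' : U -> 'Z_N,
    {morph chi' : y z / y - z} /\ {in M, chi' =1 chi}.
Proof.
move=> N1 + + + NK; have [n] := ubnP #|~: M|.
elim: n M chi => // n IH M chi Mn HM chiB chiK KM.
have [/eqP MT|] := boolP (M == finset.setTfor U).
  exists chi; split=> // y z; apply: chiB; rewrite MT; exact: finset.in_setT.
rewrite finset.eqEsubset finset.subsetT /= => /fintype.subsetPn[x _ xM].
have [chi1 [chi1B chi1M]] := extend_one N1 HM chiB chiK (NK x) KM.
have [HA MA xA] := adjoin_closed x HM.
have [|||||chi2 [chi2B chi2M]] := IH (adjoin M x) chi1 => //.
- rewrite -ltnS; apply: leq_trans Mn; rewrite ltnS; apply: proper_card.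
  rewrite properC; apply/properP; split=> //; by exists x.
- by move=> k Kk; rewrite chi1M ?chiK //; exact: (fintype.subsetP KM).
- exact: fintype.subset_trans KM MA.
exists chi2; split=> // y My; rewrite chi2M ?chi1M //; exact: (fintype.subsetP MA).
Qed.

(** Modulo [K] the element [z] has an order [m > 1] dividing [N]. Sending it to [N / m], of exact
    order [m] in Z/N, defines a character to be extended. *)
Lemma char_sep (N : nat) (U : finZmodType) (K : {set U}) (z : U) :
  (1 < N)%N -> zmod_closed K -> (forall x, x *+ N \in K) -> z \notin K ->
  exists chi : U -> 'Z_N,
    [/\ {morph chi : x y / x - y}, {in K, forall k, chi k = 0} & chi z != 0].
Proof.
move=> N1 HK NK zK.
have [m [m0 mN zm mdv]] := rel_order HK (ltnW N1) (NK z).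
have m1 : (1 < m)%N.
  rewrite ltn_neqAle m0 andbT; apply: contra zK => /eqP m1.
  by rewrite -m1 mulr1n in zm.
have [||chi [chiB chi0 chiz]] :=
    @extend_adjoin U 'Z_N K (fun=> 0) z ((N %/ m)%N%:R) HK.
- by move=> x y _ _; rewrite subrr.
- move=> a /mdv /dvdzP[b ->]; rewrite mulrC mulrzA -pmulrn -mulrnA.
  by rewrite divnK // pchar_Zp // mul0rz.
have [HA KA zA] := adjoin_closed z HK.
have chiK : {in K, forall k, chi k = 0} by move=> k Kk; rewrite chi0.
have [chi' [chi'B chi'E]] := extend_total N1 HA chiB chiK NK KA.
exists chi'; split=> //.
- by move=> k Kk; rewrite chi'E ?chiK //; exact: (fintype.subsetP KA).
- rewrite chi'E // chiz -(inj_eq val_inj) /= val_Zp_nat // -/(_ %| _)%N.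
  rewrite gtnNdvd ?divn_gt0 ?ltn_Pdiv //; first by rewrite dvdn_leq // ltnW.
  exact: ltnW.
Qed.

(** * Alternating forms on tuples *)

Lemma additive_lin (U V : zmodType) (f : U -> V) (I : finType) (h : I -> U) (c : I -> int) :
  {morph f : x y / x + y} ->
  f (\sum_i h i *~ c i) = \sum_i f (h i) *~ c i.
Proof.
move=> fD.
have f0 : f 0 = 0 by apply: (addrI (f 0)); rewrite -fD !addr0.
have fB : zmod_morphism f.
  move=> x y; apply: (addIr (f y)); rewrite -fD !subrK //.
pose F : {additive U -> V} := HB.pack f (GRing.isZmodMorphism.Build U V f fB).
by rewrite -[f]/(F : U -> V) raddf_sum; apply: eq_bigr => i _; rewrite raddfMz.
Qed.

Definition lin {V : zmodType} {n} (h : 'I_n -> V) (x : 'cV[int]_n) : V :=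
  \sum_i h i *~ x i ord0.

(** A tuple [h] stands for the homomorphism from Z^n with [h i] the image of the basis vector [i];
    [act h M] is its composite with [M]. *)
Definition act {V : finZmodType} {n m} (h : {ffun 'I_n -> V}) (M : 'M[int]_(n, m)) :
  {ffun 'I_m -> V} := [ffun j => \sum_i h i *~ M i j].

Section Lin.
Variables (V : finZmodType).

Lemma lin_is_zmod_morphism n (h : {ffun 'I_n -> V}) : zmod_morphism (lin h).
Proof.
by move=> x y; rewrite /lin -sumrB; apply: eq_bigr => i _; rewrite !mxE mulrzBr.
Qed.

HB.instance Definition _ n (h : {ffun 'I_n -> V}) :=
  GRing.isZmodMorphism.Build 'cV[int]_n V (lin h) (lin_is_zmod_morphism h).

Lemma linZ n (h : {ffun 'I_n -> V}) (a : int) x : lin h (a *: x) = lin h x *~ a.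
Proof.
rewrite /lin mulrz_suml; apply: eq_bigr => i _.
by rewrite !mxE mulrC mulrzA.
Qed.

Lemma lin_delta n (h : {ffun 'I_n -> V}) i : lin h (delta_mx i ord0) = h i.
Proof.
rewrite /lin (bigD1 i) //= big1 ?addr0 ?mxE ?eqxx // => j /negbTE ji.
by rewrite mxE ji.
Qed.

Lemma actE n m (h : {ffun 'I_n -> V}) (M : 'M[int]_(n, m)) j : act h M j = lin h (col j M).
Proof. by rewrite ffunE; apply: eq_bigr => i _; rewrite mxE. Qed.

Lemma lin_act n m (h : {ffun 'I_n -> V}) (M : 'M[int]_(n, m)) x : lin (act h M) x = lin h (M *m x).
Proof.
rewrite /lin; under eq_bigr do rewrite ffunE mulrz_suml.
rewrite exchange_big /=; apply: eq_bigr => i _.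
rewrite mxE mulrz_sumr; apply: eq_bigr => j _.
by rewrite mulrzA.
Qed.

Lemma act_mul n m p (h : {ffun 'I_n -> V}) (M : 'M[int]_(n, m))
    (N : 'M[int]_(m, p)) : act (act h M) N = act h (M *m N).
Proof.
apply/ffunP => j; rewrite !actE lin_act; congr lin.
by apply/matrixP => i k; rewrite !mxE; apply: eq_bigr => ? _; rewrite mxE.
Qed.

Lemma act1 n (h : {ffun 'I_n -> V}) : act h 1%:M = h.
Proof. by apply/ffunP => j; rewrite actE col1 lin_delta. Qed.

Lemma act_eq_mod n m (h : {ffun 'I_n -> V}) (N : nat) (M M' : 'M[int]_(n, m)) :
  (forall x : V, x *+ N = 0) -> (forall i j, (N%:Z %| M i j - M' i j)%Z) ->
  act h M = act h M'.
Proof.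
move=> VN MM; apply/ffunP => j; rewrite !ffunE; apply: eq_bigr => i _.
have /dvdzP[k /eqP] := MM i j; rewrite subr_eq => /eqP ->.
by rewrite mulrzDr mulrC mulrzA -pmulrn VN mul0rz add0r.
Qed.

End Lin.

Definition surj {V : finZmodType} {n} (h : {ffun 'I_n -> V}) : Prop :=
  forall y : V, exists x, y = lin h x.

Definition alt_bilinear {U V : zmodType} (B : U -> U -> V) : Prop :=
  [/\ forall z, {morph B^~ z : x y / x + y}, forall z, {morph B z : x y / x + y} &
      forall x, B x x = 0].

Lemma alt_bilinear_anti (U V : zmodType) (B : U -> U -> V) x y :
  alt_bilinear B -> B y x = - B x y.
Proof.
move=> [Bl Br B0]; apply/eqP; rewrite -addr_eq0.
by have := B0 (x + y); rewrite Bl !Br !B0 add0r addr0 addrC => ->.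
Qed.

Lemma bilinear_lin (U V : zmodType) (B : U -> U -> V) (I : finType) (h k : I -> U)
    (c d : I -> int) :
  alt_bilinear B ->
  B (\sum_i h i *~ c i) (\sum_i k i *~ d i) =
  \sum_i \sum_j B (h i) (k j) *~ (c i * d j).
Proof.
move=> [Bl Br _]; rewrite (additive_lin (f := B^~ _)) //; apply: eq_bigr => i _.
rewrite additive_lin // mulrz_suml; apply: eq_bigr => j _.
by rewrite mulrC mulrzA.
Qed.

(** The first row cancels the first column, and so on by induction. The diagonal is treated
    separately because [V] may have 2-torsion. *)
Lemma sum_antisym (V : zmodType) n (f : 'I_n -> 'I_n -> V) :
  (forall i, f i i = 0) -> (forall i j, f j i = - f i j) -> \sum_i \sum_j f i j = 0.
Proof.
elim: n f => [|n IH] f f0 fN; first by rewrite big_ord0.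
rewrite big_ord_recl big_ord_recl f0 add0r.
under [X in _ + X]eq_bigr do rewrite big_ord_recl fN.
rewrite big_split /= sumrN addrA subrr add0r.
exact: IH.
Qed.

Definition sumB {U V : zmodType} {n} (B : U -> U -> V) (h : 'I_n -> U)
    (X : 'M[int]_n) : V :=
  \sum_i \sum_j B (h i) (h j) *~ X i j.

Definition omegaB {U V : zmodType} {g} (B : U -> U -> V) (h : 'I_(g + g) -> U) : V :=
  \sum_(i < g) B (h (lshift g i)) (h (rshift g i)).

(** The matrix of the tensor that sums [e_i (x) e_{g+i}], lifting [omega]. Summing an alternating
    form against [Jmx] would give [2 omegaB], which loses information when [l = 2]. *)
Definition Emx (g : nat) : 'M[int]_(g + g) := block_mx 0 1%:M 0 0.

Lemma Jmx_Emx g : Jmx g = Emx g - (Emx g)^T.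
Proof.
rewrite /Jmx /Emx tr_block_mx !trmx0 trmx1 opp_block_mx add_block_mx.
by rewrite !subr0 !add0r.
Qed.

Lemma Jmx_sqr g : Jmx g *m Jmx g = - 1%:M.
Proof.
rewrite /Jmx mulmx_block !mul0mx !mulmx0 !mul1mx !mulmx1 !add0r !addr0.
by rewrite scalar_mx_block opp_block_mx !oppr0.
Qed.

Lemma Jmx_tr g : (Jmx g)^T = - Jmx g.
Proof. by rewrite Jmx_Emx linearB /= trmxK opprB. Qed.

Lemma omegaB_sumB (U V : zmodType) g (B : U -> U -> V) (h : 'I_(g + g) -> U) :
  omegaB B h = sumB B h (Emx g).
Proof.
rewrite /sumB /omegaB big_split_ord /= [X in _ + X]big1 ?addr0.
  apply: eq_bigr => i _; rewrite big_split_ord /= big1 ?add0r.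
    rewrite (bigD1 i) //= big1 ?addr0.
      by rewrite block_mxEur mxE eqxx.
    by move=> j /negbTE ij; rewrite block_mxEur mxE eq_sym ij.
  by move=> j _; rewrite block_mxEul mxE.
move=> i _; rewrite big1 // => j _; rewrite /Emx -[j]splitK.
by case: (fintype.split j) => k /=; rewrite ?block_mxEdl ?block_mxEdr mxE.
Qed.

Lemma sumBB (U V : zmodType) n (B : U -> U -> V) (h : 'I_n -> U) (X Y : 'M[int]_n) :
  sumB B h (X - Y) = sumB B h X - sumB B h Y.
Proof.
rewrite /sumB -sumrB; apply: eq_bigr => i _; rewrite -sumrB; apply: eq_bigr => j _.
by rewrite !mxE mulrzBr.
Qed.

Lemma sumBZ (U V : zmodType) n (B : U -> U -> V) (h : 'I_n -> U) (a : int)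
    (X : 'M[int]_n) :
  sumB B h (a *: X) = sumB B h X *~ a.
Proof.
rewrite /sumB mulrz_suml; apply: eq_bigr => i _.
rewrite mulrz_suml; apply: eq_bigr => j _.
by rewrite !mxE mulrC mulrzA.
Qed.

Lemma sumB_act (U : finZmodType) (V : zmodType) n m (B : U -> U -> V)
    (h : {ffun 'I_n -> U}) (M : 'M[int]_(n, m)) (X : 'M[int]_m) :
  alt_bilinear B -> sumB B (act h M) X = sumB B h (M *m X *m M^T).
Proof.
move=> HB; rewrite /sumB.
under eq_bigr do under eq_bigr do rewrite !ffunE bilinear_lin // mulrz_suml.
under eq_bigr do rewrite exchange_big /=.
rewrite exchange_big /=; apply: eq_bigr => a _.
under eq_bigr do under eq_bigr do rewrite mulrz_suml.
under eq_bigr do rewrite exchange_big /=.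
rewrite exchange_big /=; apply: eq_bigr => b _.
rewrite mxE mulrz_sumr exchange_big /=; apply: eq_bigr => j _.
rewrite !mxE mulr_suml mulrz_sumr; apply: eq_bigr => i _.
by rewrite -mulrzA; congr (_ *~ _); rewrite mulrAC.
Qed.

Lemma sumB_sym (U V : zmodType) n (B : U -> U -> V) (h : 'I_n -> U) (N : nat)
    (X : 'M[int]_n) :
  alt_bilinear B -> (forall x : U, x *+ N = 0) ->
  (forall i j, (N%:Z %| (X - X^T) i j)%Z) -> sumB B h X = 0.
Proof.
move=> HB UN XX; apply: sum_antisym => [i|i j].
  by case: HB => _ _ ->; rewrite mul0rz.
rewrite (alt_bilinear_anti (h i) (h j) HB) mulNrz; congr (- _).
have /dvdzP[k] := XX i j; rewrite !mxE => /eqP; rewrite subr_eq => /eqP ->.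
have BN x y : B x y *+ N = 0.
  case: HB => Bl _ _; have := additive_lin (fun _ : 'I_1 => x) (fun _ => N%:Z) (Bl y).
  rewrite !big_ord1 -!pmulrn UN => <-.
  by apply: (addrI (B 0 y)); rewrite -Bl !addr0.
by rewrite mulrzDr mulrC mulrzA -pmulrn BN mul0rz add0r.
Qed.

(** As [Jmx] is [Emx] minus its transpose, the congruence says that [M Emx M^T - q Emx] is symmetric
    modulo [N], and an alternating form vanishes on such a matrix. *)
Lemma omegaB_act (U : finZmodType) (V : zmodType) g (B : U -> U -> V) (N : nat) (q : int)
    (h : {ffun 'I_(g + g) -> U}) (M : 'M[int]_(g + g)) :
  alt_bilinear B -> (forall x : U, x *+ N = 0) ->
  (forall i j, (N%:Z %| (M *m Jmx g *m M^T - q *: Jmx g) i j)%Z) ->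
  omegaB B (act h M) = omegaB B h *~ q.
Proof.
move=> HB UN MJ; rewrite !omegaB_sumB sumB_act // -sumBZ; apply/eqP.
rewrite -subr_eq0 -sumBB; apply/eqP; apply: sumB_sym HB UN _ => i j.
have := MJ i j; rewrite Jmx_Emx.
suff -> : M *m (Emx g - (Emx g)^T) *m M^T - q *: (Emx g - (Emx g)^T) =
  M *m Emx g *m M^T - q *: Emx g - (M *m Emx g *m M^T - q *: Emx g)^T by [].
have trB (A A' : 'M[int]_(g + g)) : (A - A')^T = A^T - A'^T.
  by apply/matrixP => ? ?; rewrite !mxE.
have trZ (A : 'M[int]_(g + g)) : (q *: A)^T = q *: A^T.
  by apply/matrixP => ? ?; rewrite !mxE.
rewrite mulmxBr mulmxBl scalerBr trB trZ !trmx_mul trmxK mulmxA.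
by rewrite !opprB addrACA [RHS]addrACA [- (q *: _) + _]addrC.
Qed.

(** * Transvections *)

Definition sform {g} (u v : 'cV[int]_(g + g)) : int := (u^T *m Jmx g *m v) ord0 ord0.

Lemma sformDl g (u u' v : 'cV[int]_(g + g)) : sform (u + u') v = sform u v + sform u' v.
Proof. by rewrite /sform [(_ + _)^T]linearD /= !mulmxDl mxE. Qed.

Lemma sformDr g (u v v' : 'cV[int]_(g + g)) : sform u (v + v') = sform u v + sform u v'.
Proof. by rewrite /sform mulmxDr mxE. Qed.

Lemma sformZr g (a : int) (u v : 'cV[int]_(g + g)) : sform u (a *: v) = a * sform u v.
Proof. by rewrite /sform -scalemxAr mxE. Qed.

Lemma sform_anti g (u v : 'cV[int]_(g + g)) : sform u v = - sform v u.
Proof.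
rewrite /sform -[in LHS](trmxK (u^T *m Jmx g *m v)) mxE.
by rewrite !trmx_mul trmxK Jmx_tr mulNmx mulmxN mxE mulmxA.
Qed.

Lemma sform_self g (u : 'cV[int]_(g + g)) : sform u u = 0.
Proof. by have := sform_anti u u; lia. Qed.

Definition symp {g} (S : 'M[int]_(g + g)) : Prop := S *m Jmx g *m S^T = Jmx g.

Lemma symp1 g : symp (1%:M : 'M[int]_(g + g)).
Proof. by rewrite /symp trmx1 mulmx1 mul1mx. Qed.

Lemma symp_mul g (S T : 'M[int]_(g + g)) : symp S -> symp T -> symp (S *m T).
Proof.
move=> HS HT; rewrite /symp trmx_mul !mulmxA -(mulmxA S T) -(mulmxA S).
by rewrite HT HS.
Qed.

Lemma symp_inv g (S : 'M[int]_(g + g)) :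
  symp S -> S *m - (Jmx g *m S^T *m Jmx g) = 1%:M.
Proof. by move=> HS; rewrite mulmxN !mulmxA HS Jmx_sqr opprK. Qed.

Definition transv {g} (v : 'cV[int]_(g + g)) (t : int) : 'M[int]_(g + g) :=
  1%:M + t *: (v *m v^T *m Jmx g).

Lemma transv_mul g (v : 'cV[int]_(g + g)) t x :
  transv v t *m x = x + (t * sform v x) *: v.
Proof.
rewrite /transv mulmxDl mul1mx -scalemxAl -scalerA; congr (_ + _ *: _).
rewrite -!mulmxA [v^T *m _]mx11_scalar mul_mx_scalar; congr (_ *: _).
by rewrite /sform mulmxA.
Qed.

(** The two terms linear in [t] cancel because [J^2 = -1], and the quadratic one contains the factor
    [v^T J v = 0]. *)
Lemma symp_transv g (v : 'cV[int]_(g + g)) t : symp (transv v t).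
Proof.
pose W := v *m v^T.
have WJW : W *m Jmx g *m W = 0.
  rewrite /W mulmxA -[X in X *m v^T]mulmxA -[X in X *m v^T]mulmxA [v^T *m _]mulmxA.
  rewrite [X in v *m X]mx11_scalar -/(sform v v) sform_self.
  by rewrite -scalemx1 scale0r mulmx0 mul0mx.
have TJ : transv v t *m Jmx g = Jmx g - t *: W.
  by rewrite /transv mulmxDl mul1mx -scalemxAl -mulmxA Jmx_sqr mulmxN mulmx1 scalerN.
have TT : (transv v t)^T = 1%:M - t *: (Jmx g *m W).
  rewrite /transv [(_ + _)^T]linearD /= trmx1 [(_ *: _)^T]linearZ /=.
  by rewrite !trmx_mul trmxK Jmx_tr mulNmx scalerN.
rewrite /symp TJ TT mulmxBr mulmx1 mulmxBl -!scalemxAr -!scalemxAl mulmxA.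
by rewrite Jmx_sqr mulNmx mul1mx mulmxA WJW !scaler0 subr0 scalerN opprK subrK.
Qed.

Lemma lin_transv (V : finZmodType) g (h : {ffun 'I_(g + g) -> V}) v t x :
  lin (act h (transv v t)) x = lin h x + lin h v *~ (t * sform v x).
Proof. by rewrite lin_act transv_mul raddfD /= linZ. Qed.

(** A right inverse modulo an exponent of [V] suffices: [h x = (h M)(M' x)]. *)
Lemma surj_act (V : finZmodType) n (h : {ffun 'I_n -> V}) (M M' : 'M[int]_n) (N : nat) :
  (forall x : V, x *+ N = 0) -> (forall i j, (N%:Z %| (M *m M' - 1%:M) i j)%Z) ->
  surj h -> surj (act h M).
Proof.
move=> VN MM hs y; have [x ->] := hs y; exists (M' *m x).
rewrite lin_act mulmxA -lin_act; congr (lin (fun_of_fin _) x).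
rewrite -[LHS]act1; apply: act_eq_mod VN _ => i j.
by rewrite -opprB rpredN; have := MM i j; rewrite !mxE.
Qed.

(** * Quotients and the vanishing of wedge products *)

Lemma exists_quotient (U : zmodType) (D : {pred U}) :
  zmod_closed D ->
  exists (W : zmodType) (p : {additive U -> W}), forall x, (p x == 0) = (x \in D).
Proof.
move=> HD.
pose I : GRing.ZmodClosed.type U :=
  HB.pack (fun x : U => x \in D) (GRing.isZmodClosed.Build U (fun x : U => x \in D) HD).
pose Q := Quotient.quot I.
exists Q, (\pi_Q : {additive U -> Q}) => x.
have p0 : \pi_Q (0 : U) = 0 := raddf0 (\pi_Q : {additive U -> Q}).
by rewrite /= -p0 -Quotient.idealrBE subr0.
Qed.

(** Translation by [x] permutes [V], so the sum of all elements is unchanged when [#|V|] copies of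
    [x] are added. *)
Lemma mulrn_card (V : finZmodType) (x : V) : x *+ #|V| = 0.
Proof.
apply: (addrI (\sum_(y : V) y)); rewrite addr0 [RHS](reindex_inj (addIr x)) /=.
by rewrite big_split /= sumr_const.
Qed.

(** The last hypothesis encodes [c /\ y = 0] in the exterior square of [V / D], tested on the forms
    with values in Z/l^(n+1) that factor through [V / D]. *)
Lemma wedge_annihilator (l n : nat) (V : finZmodType) (D : {set V}) (x y : V) :
  prime l -> zmod_closed D -> (forall z, z *+ (l * l ^ n) \in D) ->
  x *+ l ^ n \notin D ->
  (forall B : V -> V -> 'Z_(l * l ^ n), alt_bilinear B ->
     (forall d z, d \in D -> B d z = 0) -> B (x *+ l ^ n) y = 0) ->
  y *+ l ^ n \in adjoin D (x *+ l ^ n).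
Proof.
move=> pl HD ND xD HB; apply/negP => /negP yD.
(* With [c = l ^ n x], take characters [a] killing [D] but not [c], and [b] killing
   [D + Z c] but not [l ^ n y]: then [b y] is a unit, so [a /\ b] does not vanish
   on [(c, y)]. *)
have l1 := prime_gt1 pl; have l0 := prime_gt0 pl.
have N1 : (1 < l * l ^ n)%N by rewrite -expnS -(exp1n n.+1) ltn_exp2r.
have [HA DA cA] := adjoin_closed (x *+ l ^ n) HD.
have [a [aB aD ac]] := char_sep N1 HD ND xD.
have [b [bB bA by_]] : exists chi : V -> 'Z_(l * l ^ n),
    [/\ {morph chi : x y / x - y}, {in adjoin D (x *+ l ^ n), forall k, chi k = 0} &
       chi (y *+ l ^ n) != 0].
  by apply: char_sep yD => // z; exact: (fintype.subsetP DA).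
have bD d : d \in D -> b d = 0 by move=> Dd; apply/bA/(fintype.subsetP DA).
have additive (chi : V -> 'Z_(l * l ^ n)) : {morph chi : x y / x - y} ->
    {morph chi : x y / x + y} /\ (forall z k, chi (z *+ k) = chi z *+ k).
  move=> chiB; pose F : {additive V -> 'Z_(l * l ^ n)} :=
    HB.pack chi (GRing.isZmodMorphism.Build V 'Z_(l * l ^ n) chi chiB).
  by split=> [z w|z k]; [exact: (raddfD F)|exact: (raddfMn F)].
have [aD' aM] := additive _ aB; have [bD' bM] := additive _ bB.
have := HB (fun z w => a z * b w - a w * b z) _ _.
rewrite (bA _ cA) mulr0 subr0 aM => /(_ _ _)/eqP.
(* If [l] divided [b y], then [b (l^n y)] would be a multiple of [l^(n+1)], hence zero. *)
have by_unit : b y \is a GRing.unit.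
  suff lb : coprime l (b y).
    by rewrite -[b y]natr_Zp unitZpE // coprimeMl lb coprimeXl.
  rewrite prime_coprime //; apply: contra by_ => /dvdnP[k Ek].
  by rewrite bM -[b y]natr_Zp Ek -mulrnA -mulnA [(k * _)%N]mulnC mulrnA pchar_Zp // mul0rn.
rewrite mulIr_eq0; last exact: mulIr.
rewrite -aM (negbTE ac) => H; suff : false by [].
apply: H => [|d z dD].
  split=> [z|z|z] /=; last by rewrite subrr.
  - by move=> v w; rewrite aD' bD' mulrDl mulrDr opprD addrACA.
  - by move=> v w; rewrite aD' bD' mulrDl mulrDr opprD addrACA.
by rewrite (aD d dD) (bD d dD) mulr0 mul0r subrr.
Qed.

(** Expanding [(h_i + a_i c) /\ (h_{g+i} + a_{g+i} c)], the term in [c /\ c] vanishes and the cross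
    terms collect into [- c /\ h(v)], where [v] is the symplectic dual of [a]. *)
Lemma omegaB_shift (V W Z : zmodType) (p : {additive V -> W}) (B : V -> V -> Z) g
    (h h' : 'I_(g + g) -> V) (c : V) (a : 'I_(g + g) -> int) :
  alt_bilinear B -> (forall d z, p d = 0 -> B d z = 0) ->
  (forall i, p (h' i) = p (h i) + p c *~ a i) ->
  omegaB B h' = omegaB B h -
    B c (lin h (col_mx (\col_i a (rshift g i)) (- \col_i a (lshift g i)))).
Proof.
move=> HB Bp hh; have [Bl Br B0] := HB.
have Bsum := additive_lin _ _ (Br c).
have Beq x x' y y' : p x = p x' -> p y = p y' -> B x y = B x' y'.
  move=> px py.
  have Bx w : B x w = B x' w.
    rewrite -[x](subrK x') Bl Bp ?add0r //.
    by rewrite raddfB /= px subrr.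
  have By w : B w y = B w y'.
    rewrite (alt_bilinear_anti y w HB) (alt_bilinear_anti y' w HB); congr (- _).
    rewrite -[y](subrK y') Bl Bp ?add0r //.
    by rewrite raddfB /= py subrr.
  by rewrite Bx By.
have mB (z w : V) (k : int) : B z (w *~ k) = B z w *~ k.
  by have := additive_lin (fun _ : 'I_1 => w) (fun=> k) (Br z); rewrite !big_ord1.
have mBl (z w : V) (k : int) : B (w *~ k) z = B w z *~ k.
  by have := additive_lin (fun _ : 'I_1 => w) (fun=> k) (Bl z); rewrite !big_ord1.
rewrite /lin Bsum big_split_ord /= opprD -!sumrN addrA /omegaB -!big_split /=.
apply: eq_bigr => i _.
rewrite col_mxEu col_mxEd !mxE mulrNz opprK.
rewrite (Beq _ (h (lshift g i) + c *~ a (lshift g i)) _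
             (h (rshift g i) + c *~ a (rshift g i))); first last.
- by rewrite hh raddfD /= raddfMz.
- by rewrite hh raddfD /= raddfMz.
rewrite Bl !Br !mB !mBl B0 !mul0rz addr0 (alt_bilinear_anti c _ HB) mulNrz.
by [].
Qed.

(** * Transitivity of the symplectic group *)

Lemma lin_congr (V W : zmodType) (p : {additive V -> W}) g
    (h h' : 'I_(g + g) -> V) (C : W) (a : 'I_(g + g) -> int) z :
  (forall i, p (h' i) = p (h i) + C *~ a i) ->
  p (lin h' z) = p (lin h z) +
    C *~ sform (col_mx (\col_i a (rshift g i)) (- \col_i a (lshift g i))) z.
Proof.
move=> hh; rewrite /lin !raddf_sum.
(* The vector is chosen so that pairing with it is the linear form of coefficients [a]. *)
have -> : sform (col_mx (\col_i a (rshift g i)) (- \col_i a (lshift g i))) z =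
    \sum_i a i * z i ord0.
  rewrite sform_anti /sform -mulmxA mul_block_col !mul0mx !mul1mx mulNmx mul1mx add0r addr0.
  rewrite mxE -sumrN; apply: eq_bigr => i _; rewrite !mxE mulrC -mulNr; congr (_ * _).
  by case: splitP => j ij; rewrite !mxE ?opprK; congr a; apply: val_inj.
rewrite mulrz_sumr -big_split; apply: eq_bigr => i _ /=.
by rewrite !raddfMz hh mulrzDl mulrzA.
Qed.

Lemma prime_inv_mod (l : nat) (b : int) :
  prime l -> ~~ (l%:Z %| b)%Z -> exists b', (l%:Z %| 1 - b * b')%Z.
Proof.
move=> pl lb; have /coprimezP[[u v] /= uv] : coprimez l b.
  by rewrite /coprimez /gcdz eqz_nat -/(coprime _ _) prime_coprime.
by exists v; rewrite -uv; apply/dvdzP; exists u; lia.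
Qed.

Lemma sp_transitive_step (l n : nat) (V : finZmodType) (D : {set V}) (x : V) g
    (h h' : {ffun 'I_(g + g) -> V}) :
  prime l -> zmod_closed D -> (forall z, z *+ (l * l ^ n) \in D) ->
  x *+ l ^ n \notin D -> surj h -> surj h' ->
  (forall B : V -> V -> 'Z_(l * l ^ n), alt_bilinear B -> omegaB B h = omegaB B h') ->
  (forall i, h' i - h i \in adjoin D (x *+ l ^ n)) ->
  exists S, symp S /\ forall i, h' i - act h S i \in D.
Proof.
move=> pl HD ND xD hs hs' HB hh.
have l0 := prime_gt0 pl.
have [W [p pD]] := exists_quotient HD.
set u := (l ^ n)%N in ND xD hh HB *.
have pN z : p z *+ u *~ l = 0.
  by rewrite -pmulrn -mulrnA mulnC -raddfMn; apply/eqP; rewrite pD.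
set c := x *+ u in xD hh *.
have Cl k : (l%:Z %| k)%Z -> p c *~ k = 0.
  by case/dvdzP => k' ->; rewrite mulrC mulrzA raddfMn pN mul0rz.
have [a Ha] : exists a : 'I_(g + g) -> int, forall i, p (h' i) = p (h i) + p c *~ a i.
  apply: (@fin_all_exists _ (fun=> int) (fun i a => p (h' i) = p (h i) + p c *~ a)) => i.
  have /adjoinP[b] := hh i; rewrite -pD !raddfB raddfMz subr_eq0 subr_eq addrC.
  by move=> /eqP ?; exists b.
pose v : 'cV[int]_(g + g) := col_mx (\col_i a (rshift g i)) (- \col_i a (lshift g i)).
have hv z : p (lin h' z) = p (lin h z) + p c *~ sform v z by exact: lin_congr.
(* Both tuples have the same image of [omega], so [omegaB_shift] leaves [c /\ h(v) = 0] modulo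
   [D]. *)
have yD : lin h v *+ u \in adjoin D c.
  apply: wedge_annihilator pl HD ND xD _ => B altB BD.
  have Bp d z : p d = 0 -> B d z = 0 by move=> /eqP; rewrite pD => /BD ->.
  have := omegaB_shift altB Bp Ha; rewrite HB // => /eqP.
  by rewrite -subr_eq0 opprB addrC subrK => /eqP.
have {yD} [b yb] : exists b, p (lin h v) *+ u = p c *~ b.
  have /adjoinP[b] := yD; rewrite -pD raddfB subr_eq0 raddfMn raddfMz => /eqP.
  by exists b.
suff [S [HS HSz]] : exists S, symp S /\ forall z, p (lin h' z) = p (lin (act h S) z).
  exists S; split=> // i; rewrite -pD raddfB subr_eq0.
  by rewrite -(lin_delta h') -(lin_delta (act h S)) HSz.
(* If [b] is a unit, then [l ^ n h(v)] generates [Z c] modulo [D] and a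
   transvection along [v] is enough. *)
have [lb|lb] := boolP (l%:Z %| b)%Z; last first.
  have [b' bb'] := prime_inv_mod pl lb.
  exists (transv v (u%:Z * b')); split; first exact: symp_transv.
  move=> z; rewrite lin_transv raddfD raddfMz -mulrA mulrzA -pmulrn yb -mulrzA hv.
  congr (_ + _); apply/eqP; rewrite -subr_eq0 -mulrzBr; apply/eqP/Cl.
  have -> : sform v z - b * (b' * sform v z) = (1 - b * b') * sform v z by ring.
  exact: dvdz_mulr.
have yu : p (lin h v) *+ u = 0 by rewrite yb Cl.
(* Otherwise a transvection along [v + w1] adds [<v, .> c] and an unwanted
   [<w1, .> c], which a transvection along [w1] cancels provided that
   [1 + u <v, w1>] is a unit.  Only [u = 1] needs care: there surjectivity of
   [h'] supplies [w1]. *)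
have [w1 [w1x w1l]] : exists w1,
    p (lin h w1) = p x /\ ~~ (l%:Z %| 1 + u%:Z * sform v w1)%Z.
  have l1 (k : int) : (l%:Z %| k)%Z -> ~~ (l%:Z %| 1 + k)%Z.
    move=> lk; rewrite rpredDr //.
    by rewrite dvdz1 /=; apply: contraTneq pl => /= ->.
  have [w0 w0x] := hs x.
  have [w0l|w0l] := boolP (l%:Z %| 1 + u%:Z * sform v w0)%Z; last by exists w0; rewrite w0x.
  have [n0|n0] := posnP n; last first.
    exfalso; move: w0l; apply/negP; apply: l1.
    by rewrite /u -(prednK n0) expnS PoszM -mulrA; exact: dvdz_mulr.
  have u1 : u = 1%N by rewrite /u n0 expn0.
  have cx : c = x by rewrite /c u1 mulr1n.
  have [w wx] := hs' x.
  (* Here [c = x], so modulo [D] this vector has image [h(w) + <v, w> x = h'(w) = x]. Its pairing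
     with [v] is [<v, w> (1 + <v, w0>)], a multiple of [l]. *)
  exists (w + sform v w *: w0); split.
    by rewrite raddfD /= linZ -w0x raddfD raddfMz -cx -hv -wx cx.
  apply: l1; rewrite u1 mul1r sformDr sformZr -[X in X + _]mulr1 -mulrDr.
  by apply: dvdz_mull; rewrite u1 mul1r in w0l.
(* After the first transvection [w1] maps to an element whose [u]-multiple is [(1 + u <v, w1>) c]
   modulo [D]. With [m] inverse to that factor modulo [l], the second transvection contributes
   exactly [- <w1, z> c]. *)
have [m Hm] := prime_inv_mod pl w1l.
exists (transv (v + w1) u%:Z *m transv w1 (- m * u%:Z)); split.
  by apply: symp_mul; exact: symp_transv.
have pT z : p (lin (act h (transv (v + w1) u%:Z)) z) =
    p (lin h z) + p c *~ sform (v + w1) z.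
  rewrite lin_transv raddfD raddfMz raddfD /= raddfD /= mulrzA -pmulrn mulrnDl yu add0r.
  by rewrite w1x -raddfMn.
move=> z; rewrite -act_mul lin_transv raddfD raddfMz pT.
have -> : - m * u%:Z * sform w1 z = u%:Z * (- m * sform w1 z) by ring.
rewrite mulrzA -pmulrn pT mulrnDl w1x -raddfMn -/c [_ *~ _ *+ u]pmulrn -mulrzA.
rewrite -[p c in X in _ + _ + X]mulr1z -mulrzDr -mulrzA -addrA -mulrzDr hv.
congr (_ + _); apply/eqP; rewrite -subr_eq0 -mulrzBr; apply/eqP/Cl.
rewrite !sformDl sform_self addr0.
have -> : sform v z - (sform v z + sform w1 z + (1 + sform v w1 * u%:Z) * (- m * sform w1 z)) =
  - ((1 - (1 + u%:Z * sform v w1) * m) * sform w1 z) by ring.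
by rewrite rpredN; exact: dvdz_mulr.
Qed.

(** Induction on the size of the complement of [D]. The target of the forms is left arbitrary
    because the exponent of [V / D], which serves as modulus, varies during the induction. *)
Lemma sp_transitive_mod (l : nat) (V : finZmodType) (D : {set V}) g
    (h h' : {ffun 'I_(g + g) -> V}) :
  prime l -> l.-nat #|V| -> zmod_closed D -> surj h -> surj h' ->
  (forall (W : zmodType) (B : V -> V -> W), alt_bilinear B -> omegaB B h = omegaB B h') ->
  exists S, symp S /\ forall i, h' i - act h S i \in D.
Proof.
move=> pl lV + hs hs' HB; have [k] := ubnP #|~: D|.
elim: k D => // k IH D Dk HD.
have VN := mulrn_card (V := V); have /p_natP[r Er] := lV.
have exn : exists n, [forall z : V, z *+ l ^ n \in D].
  by exists r; apply/forallP => z; rewrite -Er VN; case: HD.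
(* In the first case the exponent of [V / D] is 1 and [D] is everything. Otherwise it is [l^(n+1)],
   and minimality yields [x] with [l^n x] outside [D]. *)
case: (ex_minnP exn) => [[|n]] /forallP Dn nmin.
  exists 1%:M; split=> [|i]; first exact: symp1.
  by have := Dn (h' i - act h 1%:M i); rewrite expn0 mulr1n.
have /forallPn[x xD] : ~~ [forall z : V, z *+ l ^ n \in D].
  by apply/negP => /nmin; rewrite ltnn.
have [HA DA cA] := adjoin_closed (x *+ l ^ n) HD.
have [|S [HS hS]] := IH (adjoin D (x *+ l ^ n)) _ HA.
  rewrite -ltnS; apply: leq_trans Dk; rewrite ltnS; apply: proper_card.
  by rewrite properC; apply/properP; split=> //; exists (x *+ l ^ n).
have hSs : surj (act h S).
  apply: (surj_act (N := #|V|) (M' := - (Jmx g *m S^T *m Jmx g))) => //.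
  by move=> i j; rewrite symp_inv // subrr mxE dvdz0.
have [| |S' [HS' hS']] := sp_transitive_step (n := n) pl HD _ xD hSs hs' _ hS.
- by move=> z; rewrite -expnS.
- move=> B altB; rewrite -HB //.
  rewrite (omegaB_act (N := #|V|) (q := 1)) ?mulr1z //.
  by move=> i j; rewrite HS scale1r subrr mxE dvdz0.
by exists (S *m S'); split; [exact: symp_mul|rewrite -act_mul].
Qed.

Lemma sp_transitive (l : nat) (V : finZmodType) g (h h' : {ffun 'I_(g + g) -> V}) :
  prime l -> l.-nat #|V| -> surj h -> surj h' ->
  (forall (W : zmodType) (B : V -> V -> W), alt_bilinear B -> omegaB B h = omegaB B h') ->
  exists S, symp S /\ h' = act h S.
Proof.
move=> pl lV hs hs' HB.
have D0 : zmod_closed ([set 0]%SET : {set V}).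
  by split=> [|x y]; rewrite !finset.inE // => /eqP -> /eqP ->; rewrite subrr.
have [S [HS hS]] := sp_transitive_mod pl lV D0 hs hs' HB.
exists S; split=> //; apply/ffunP => i; apply/eqP; rewrite -subr_eq0.
by have := hS i; rewrite finset.inE.
Qed.

(** * The exterior square and congruences of matrices *)

Definition evalB {U : finZmodType} {V : zmodType} (B : U -> U -> V)
  (w : {ffun U * U -> int}) : V := \sum_p B p.1 p.2 *~ w p.

Lemma evalB_is_zmod_morphism (U : finZmodType) (V : zmodType) (B : U -> U -> V) :
  zmod_morphism (evalB B).
Proof.
by move=> x y; rewrite /evalB -sumrB; apply: eq_bigr => p _; rewrite !ffunE mulrzBr.
Qed.

HB.instance Definition _ (U : finZmodType) (V : zmodType) (B : U -> U -> V) :=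
  GRing.isZmodMorphism.Build {ffun U * U -> int} V (evalB B) (evalB_is_zmod_morphism B).

Lemma evalB_wdelta (U : finZmodType) (V : zmodType) (B : U -> U -> V) a b :
  evalB B (wdelta a b) = B a b.
Proof.
rewrite /evalB (bigD1 (a, b)) //= big1 ?addr0 ?ffunE ?eqxx // => p /negbTE pab.
by rewrite ffunE pab.
Qed.

Lemma evalB_wedge_map (U U' : finZmodType) (V : zmodType) (B : U' -> U' -> V)
    (f : U -> U') w :
  evalB B (wedge_map f w) = evalB (fun a b => B (f a) (f b)) w.
Proof.
rewrite /wedge_map raddf_sum; apply: eq_bigr => p _.
by rewrite raddfMz /= evalB_wdelta.
Qed.

Lemma wdelta_decomp (U : finZmodType) (w : {ffun U * U -> int}) :
  w = \sum_p wdelta p.1 p.2 *~ w p.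
Proof.
apply/ffunP => q; rewrite sum_ffunE (bigD1 q) //= big1 ?addr0.
  by rewrite ffunMzE ffunE -surjective_pairing eqxx intz.
move=> p /negbTE pq; rewrite ffunMzE ffunE -surjective_pairing eq_sym pq.
by rewrite mul0rz.
Qed.

Lemma wedge_rel_zmod_closed (U : finZmodType) :
  zmod_closed ((fun w : {ffun U * U -> int} => `[< wedge_rel w >]) : {pred _}).
Proof.
split=> [|x y].
  apply/asboolP; exists 0, 0, 0.
  by rewrite !big1 ?addr0 // => i _; rewrite ffunE mulr0z.
move=> /asboolP[cl [cr [ca ->]]] /asboolP[cl' [cr' [ca' ->]]]; apply/asboolP.
exists (cl - cl'), (cr - cr'), (ca - ca').
under [in RHS]eq_bigr do rewrite !ffunE mulrzBr.
under [X in _ = _ + X + _]eq_bigr do rewrite !ffunE mulrzBr.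
under [X in _ = _ + X]eq_bigr do rewrite !ffunE mulrzBr.
rewrite !sumrB !opprD.
by rewrite addrACA; congr (_ + _); rewrite addrACA.
Qed.

(** The universal property of the exterior square: alternating forms kill the relations, and
    conversely the quotient by the relations carries a universal alternating form. It replaces
    formal sums by forms from here on. *)
Lemma wedge_eqP (U : finZmodType) (w1 w2 : {ffun U * U -> int}) :
  wedge_eq w1 w2 <->
  forall (V : zmodType) (B : U -> U -> V), alt_bilinear B -> evalB B w1 = evalB B w2.
Proof.
split=> [[cl [cr [ca Ew]]] V B [Bl Br B0]|HB].
  apply/eqP; rewrite -subr_eq0 -raddfB Ew !raddfD !raddf_sum !big1 ?addr0 // => t _.
  - by rewrite raddfMz /= evalB_wdelta B0 mul0rz.
  - by rewrite raddfMz !raddfB /= !evalB_wdelta Br addrAC addrK subrr mul0rz.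
  - by rewrite raddfMz !raddfB /= !evalB_wdelta Bl addrAC addrK subrr mul0rz.
have [W [p pD]] := exists_quotient (wedge_rel_zmod_closed U).
have p0 w : wedge_rel w -> p w = 0.
  by move=> Hw; apply/eqP; rewrite pD; apply/asboolP.
apply/asboolP; rewrite -[asbool _]/(_ \in (fun w => `[< wedge_rel w >])) -pD.
have pE w : p w = evalB (fun a b => p (wdelta a b)) w.
  rewrite {1}(wdelta_decomp w) raddf_sum; apply: eq_bigr => q _.
  by rewrite raddfMz.
rewrite raddfB subr_eq0 !pE; apply/eqP/HB; split=> [z x y|z x y|x].
- apply/eqP; rewrite -subr_eq0 opprD addrA -!raddfB; apply/eqP/p0.
  exists [ffun t => (t == (x, y, z))%:Z], 0, 0.
  rewrite (bigD1 (x, y, z)) //= ffunE eqxx mulr1z.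
  rewrite !big1 ?addr0 // => t; rewrite ffunE ?mulr0z //.
  by move=> /negbTE ->; rewrite mulr0z.
- apply/eqP; rewrite -subr_eq0 opprD addrA -!raddfB; apply/eqP/p0.
  exists 0, [ffun t => (t == (z, x, y))%:Z], 0.
  rewrite [X in _ = _ + X + _](bigD1 (z, x, y)) //= ffunE eqxx mulr1z.
  rewrite !big1 ?addr0 ?add0r // => t; rewrite ffunE ?mulr0z //.
  by move=> /negbTE ->; rewrite mulr0z.
- apply: p0; exists 0, 0, [ffun t => (t == x)%:Z].
  rewrite [X in _ + X](bigD1 x) //= ffunE eqxx mulr1z.
  rewrite !big1 ?addr0 ?add0r // => t; rewrite ffunE ?mulr0z //.
  by move=> /negbTE ->; rewrite mulr0z.
Qed.

Lemma evalB_omega (U : finZmodType) (V : zmodType) g (B : U -> U -> V)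
    (h : 'I_(g + g) -> U) :
  evalB B (\sum_(i < g) wdelta (h (lshift g i)) (h (rshift g i))) = omegaB B h.
Proof. by rewrite raddf_sum; apply: eq_bigr => i _; rewrite /= evalB_wdelta. Qed.

Definition eqmx_mod (N : nat) {m n} (A A' : 'M[int]_(m, n)) : Prop :=
  forall i j, (N%:Z %| (A - A') i j)%Z.

Lemma eqmx_mod_refl N m n (A : 'M[int]_(m, n)) : eqmx_mod N A A.
Proof. by move=> i j; rewrite subrr mxE dvdz0. Qed.

Lemma eqmx_mod_mul N m n k (A A' : 'M[int]_(m, n)) (B B' : 'M[int]_(n, k)) :
  eqmx_mod N A A' -> eqmx_mod N B B' -> eqmx_mod N (A *m B) (A' *m B').
Proof.
move=> HA HB i j.
have -> : A *m B - A' *m B' = (A - A') *m B + A' *m (B - B').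
  by rewrite mulmxBl mulmxBr addrA subrK.
rewrite mxE; apply: rpredD; rewrite mxE; apply: rpred_sum => k' _.
  exact: dvdz_mulr.
exact: dvdz_mull.
Qed.

Lemma eqmx_mod_tr N m n (A A' : 'M[int]_(m, n)) : eqmx_mod N A A' -> eqmx_mod N A^T A'^T.
Proof. by move=> HA i j; have := HA j i; rewrite !mxE. Qed.

Lemma eqmx_mod_red (l k : nat) m n (A : 'M[int]_(m, n)) :
  eqmx_mod (l ^ k.+1) (map_mx (red l k) A) A.
Proof.
move=> i j; rewrite !mxE /red /modz -addrA addrCA subrr addr0 rpredN.
exact: dvdz_mull.
Qed.

Lemma eqmx_modP (l k : nat) m n (A A' : 'M[int]_(m, n)) :
  map_mx (red l k) A = map_mx (red l k) A' <-> eqmx_mod (l ^ k.+1) A A'.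
Proof.
split=> [/matrixP H i j|H].
  by have := H i j; rewrite !mxE -eqz_mod_dvd => /eqP.
by apply/matrixP => i j; have := H i j; rewrite !mxE -eqz_mod_dvd => /eqP.
Qed.

Lemma act_eqmx (V : finZmodType) n m (N : nat) (h : {ffun 'I_n -> V})
    (A A' : 'M[int]_(n, m)) :
  (forall x : V, x *+ N = 0) -> eqmx_mod N A A' -> act h A = act h A'.
Proof.
by move=> VN AA; apply: act_eq_mod VN _ => i j; have := AA i j; rewrite !mxE.
Qed.

(** If [#|V| = l^r] then [r < #|V|]. As the residues of index [k] are taken modulo [l^(k+1)], those
    of index [#|V|] determine the action on [V]. *)
Lemma lgroup_exponent (l : nat) (V : finZmodType) (x : V) :
  prime l -> l.-nat #|V| -> x *+ l ^ #|V|.+1 = 0.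
Proof.
move=> pl /p_natP[r Er].
have -> : (l ^ #|V|.+1 = #|V| * l ^ (#|V|.+1 - r))%N.
  rewrite {2}Er -expnD subnKC //; apply: leq_trans (leqnSn _).
  by rewrite Er ltnW // ltn_expl // prime_gt1.
by rewrite mulrnA mulrn_card mul0rn.
Qed.

(** From [F J F^T = q J] and [J^2 = -1], the matrix [- q^(-1) J F^T J] is a right inverse; [v] below
    is the inverse of [q] modulo [l^k]. *)
Lemma similitude_right_inverse (l q k g : nat) (F : 'M[int]_(g + g)) :
  prime l -> ~~ (l %| q)%N -> eqmx_mod (l ^ k) (F *m Jmx g *m F^T) (q%:Z *: Jmx g) ->
  exists F', eqmx_mod (l ^ k) (F *m F') 1%:M.
Proof.
move=> pl lq HF.
have /coprimezP[[u v] /= uv] : coprimez (l ^ k)%N q.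
  by rewrite /coprimez /gcdz eqz_nat -/(coprime _ _) coprimeXl // prime_coprime.
exists (- v *: (Jmx g *m F^T *m Jmx g)) => i j.
have := eqmx_mod_mul HF (eqmx_mod_refl _ (- v *: Jmx g)) i j.
have -> : F *m (- v *: (Jmx g *m F^T *m Jmx g)) = F *m Jmx g *m F^T *m (- v *: Jmx g).
  by rewrite -!scalemxAr !mulmxA.
set X := F *m _ *m _ *m _.
have -> : q%:Z *: Jmx g *m (- v *: Jmx g) = (1 - u * (l ^ k)%N%:Z) *: 1%:M.
  rewrite -scalemxAl -scalemxAr Jmx_sqr scalerN -scaleNr scalerA -uv.
  by congr (_ *: _); ring.
have -> : X - 1%:M = X - (1 - u * (l ^ k)%N%:Z) *: 1%:M - (u * (l ^ k)%N%:Z) *: 1%:M.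
  by rewrite scalerBl scale1r -addrA -opprD subrK.
move=> H; rewrite mxE; apply: rpredD => //.
by rewrite !mxE rpredN; apply/dvdz_mulr/dvdz_mull.
Qed.

Lemma eqmx_mod_dvd (N N' : nat) m n (A A' : 'M[int]_(m, n)) :
  (N' %| N)%N -> eqmx_mod N A A' -> eqmx_mod N' A A'.
Proof. by move=> NN AA i j; apply: dvdz_trans (AA i j). Qed.

Lemma dvdz_det_eqmx (l n : nat) (A A' : 'M[int]_n) :
  prime l -> eqmx_mod l A A' -> (l%:Z %| \det A)%Z = (l%:Z %| \det A')%Z.
Proof.
move=> pl AA; rewrite !(dvdz_pcharf (pchar_Fp pl)).
rewrite -!(det_map_mx (intr : {rmorphism int -> 'F_l})).
suff -> : map_mx (intr : int -> 'F_l) A = map_mx intr A' by [].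
apply/matrixP => i j; rewrite !mxE; apply/eqP.
rewrite -subr_eq0 -intrB -(dvdz_pcharf (pchar_Fp pl)).
by have := AA i j; rewrite !mxE.
Qed.

Lemma gsp_coset_symp (l g : nat) (S : 'M[int]_(g + g)) :
  prime l -> symp S -> sp_group l g (fun k => map_mx (red l k) S).
Proof.
move=> pl HS; split=> [k||k].
- apply/eqmx_modP => i j; rewrite -opprB mxE rpredN.
  apply: eqmx_mod_dvd (eqmx_mod_red l k.+1 S) i j.
  by rewrite [X in (_ %| X)%N]expnS dvdn_mull.
- have -> := dvdz_det_eqmx pl (eqmx_mod_red l 0 S).
  have /(congr1 determinant) := symp_inv HS; rewrite det_mulmx det1 => dS.
  apply: contraL (prime_gt1 pl) => /(dvdz_mulr (\det (- (Jmx g *m S^T *m Jmx g)))).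
  by rewrite dS dvdz1 /= => /eqP ->.
- apply/eqmx_modP; rewrite scale1r -{2}HS; apply: eqmx_mod_mul.
    by apply: eqmx_mod_mul; [exact: eqmx_mod_red|exact: eqmx_mod_refl].
  exact/eqmx_mod_tr/eqmx_mod_red.
Qed.

(** * Symplectic tuples *)

(** On the kernel of [FH], [P(FH) = 0] reads [P(0) x = 0]. As [P(0)] is prime to [l] and [H] is an
    [l]-group, [x = 0]. *)
Lemma killed_by_unit_poly_inj (l : nat) (H : finZmodType) (P : nat -> {poly int})
    (FH : {additive H -> H}) :
  prime l -> l.-nat #|H| -> zl_poly l P -> ~~ ((l%:Z %| (P 0%N)`_0)%Z) ->
  poly_kills l P FH -> injective FH.
Proof.
move=> pl lH zP lP0 PFH.
have lPk k : ~~ (l%:Z %| (P k)`_0)%Z.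
  elim: k => // k; apply: contra => lk.
  rewrite zP coef_map_id0; last by rewrite /red mod0z.
  rewrite /red /modz; apply: rpredB => //; apply: dvdz_mull.
  by rewrite dvdzE /= expnS dvdn_mulr.
suff ker x : FH x = 0 -> x = 0.
  by move=> x y xy; apply/eqP; rewrite -subr_eq0; apply/eqP/ker; rewrite raddfB /= xy subrr.
move=> x0; have := PFH x.
have itx i : iter i.+1 FH x = 0 by elim: i => //= i ->; rewrite raddf0.
have sP : (0 < size (P #|H|))%N.
  by rewrite lt0n size_poly_eq0; apply: contra (lPk #|H|) => /eqP ->; rewrite coef0 dvdz0.
rewrite -[size _](prednK sP) big_ord_recl big1 ?addr0 /=; last first.
  by move=> i _; rewrite -iterS itx mul0rz.
move=> Px; have [b' /dvdzP[k Hk]] := prime_inv_mod pl (lPk #|H|).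
have xl : x = x *~ l%:Z *~ k.
  by rewrite -mulrzA mulrC -Hk mulrzBr mulr1z mulrzA Px mul0rz subr0.
(* Iterating [x = l k x] makes [x] a multiple of [l^n x] for every [n], which is zero for large
   [n]. *)
suff xn n : exists k, x = x *~ (l ^ n)%N%:Z *~ k.
  by have [k' ->] := xn #|H|.+1; rewrite -pmulrn lgroup_exponent // mul0rz.
elim: n => [|n [k' IH]]; first by exists 1; rewrite expn0 !mulr1z.
exists (k * k'); rewrite {1}IH {1}xl -!mulrzA; congr (_ *~ _).
by rewrite expnS PoszM; ring.
Qed.

(** The image of [omega] is compared with [wH] through all alternating forms, the shape in which
    [sp_transitive] takes its hypothesis; [wedge_eqP] gives the equivalence with [wedge_eq]. *)
Definition sympl_tuple {H : finZmodType} (wH : {ffun H * H -> int}) {g}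
    (h : {ffun 'I_(g + g) -> H}) : Prop :=
  surj h /\ forall (V : zmodType) (B : H -> H -> V), alt_bilinear B ->
    omegaB B h = evalB B wH.

Lemma act_mxpow (H : finZmodType) n (FH : {additive H -> H}) (h : {ffun 'I_n -> H})
    (A : 'M[int]_n) i :
  act h A = [ffun j => FH (h j)] -> act h (mxpow A i) = [ffun j => iter i FH (h j)].
Proof.
move=> hA; elim: i => [|i IH].
  by rewrite /mxpow /= act1; apply/ffunP => j; rewrite ffunE.
rewrite /mxpow /= -/(mxpow A i) -act_mul hA.
apply/ffunP => j; have := congr1 (fun f : {ffun _ -> _} => FH (f j)) IH.
rewrite !ffunE raddf_sum /= => <-; apply: eq_bigr => k _.
by rewrite ffunE raddfMz.
Qed.

Lemma act_mxhorner (l : nat) (H : finZmodType) n (P : nat -> {poly int})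
    (FH : {additive H -> H}) (h : {ffun 'I_n -> H}) (A : 'M[int]_n) :
  poly_kills l P FH -> act h A = [ffun j => FH (h j)] ->
  act h (mxhorner (P #|H|) A) = [ffun=> 0].
Proof.
move=> PFH hA; apply/ffunP => j; rewrite [RHS]ffunE -[RHS](PFH (h j)) actE.
have -> : col j (mxhorner (P #|H|) A) =
    \sum_(i < size (P #|H|)) (P #|H|)`_i *: col j (mxpow A i).
  by apply/matrixP => a b; rewrite mxE /mxhorner !summxE; apply: eq_bigr => i _; rewrite !mxE.
rewrite raddf_sum; apply: eq_bigr => i _.
by rewrite /= linZ -actE (act_mxpow i hA) ffunE.
Qed.

(** If [h F = FH h] then [h P(F) = P(FH) h = 0], so [h] factors through the cokernel of [P(F)]. *)
Lemma good_tupleP (l g : nat) (H : finZmodType) (wH : {ffun H * H -> int})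
    (P : nat -> {poly int}) (FH : {additive H -> H}) F (h : {ffun 'I_(g + g) -> H}) :
  prime l -> l.-nat #|H| -> poly_kills l P FH ->
  good_tuple l g P FH wH F h <->
  sympl_tuple wH h /\ act h (F #|H|) = [ffun j => FH (h j)].
Proof.
move=> pl lH PFH; split.
  move=> [_ hs hF /wedge_eqP hw]; split; [split|].
  - by move=> y; have [a ->] := hs y; exists (\col_i a i); apply: eq_bigr => i _; rewrite mxE.
  - by move=> V B altB; rewrite -evalB_omega hw.
  - by apply/ffunP => j; rewrite !ffunE hF.
move=> [[hs hw] hF]; split.
- move=> j; set M := map_mx _ _.
  have : act h M j = 0.
    rewrite (act_eqmx h (fun x => lgroup_exponent x pl lH) (eqmx_mod_red l #|H| _)).
    by rewrite (act_mxhorner PFH hF) ffunE.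
  by rewrite ffunE.
- by move=> y; have [x ->] := hs y; exists (fun i => x i ord0).
- by move=> j; have := congr1 (fun f : {ffun _ -> _} => f j) hF; rewrite !ffunE.
- by apply/wedge_eqP => V B altB; rewrite evalB_omega hw.
Qed.

(** An injective [FH] on a finite group is an automorphism. It carries [wH] to [q wH], so pulling
    forms back along its inverse shows that [FH^(-1) k] carries [omega] to [wH]. *)
Lemma sympl_tuple_preimage (H : finZmodType) (wH : {ffun H * H -> int}) (q g : nat)
    (FH : {additive H -> H}) (k : {ffun 'I_(g + g) -> H}) :
  injective FH -> wedge_eq (wedge_map FH wH) (wH *+ q) ->
  sympl_tuple (wH *+ q) k -> exists2 h, sympl_tuple wH h & k = [ffun j => FH (h j)].
Proof.
move=> FHi /wedge_eqP Fq [ks kw].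
pose G := invF FHi.
have FG : cancel G FH := f_invF FHi; have GF : cancel FH G := invF_f FHi.
have GD : {morph G : x y / x + y} by move=> x y; apply: (FHi); rewrite raddfD /= !FG.
exists [ffun j => G (k j)]; last by apply/ffunP => j; rewrite !ffunE FG.
split=> [y|V B altB].
  have [x Ex] := ks (FH y); exists x; apply: (FHi); rewrite Ex /lin raddf_sum.
  by apply: eq_bigr => i _; rewrite raddfMz /= ffunE FG.
have altBG : alt_bilinear (fun a b => B (G a) (G b)).
  by case: altB => Bl Br B0; split=> [z x y|z x y|x]; rewrite ?GD ?Bl ?Br ?B0.
have -> : omegaB B [ffun j => G (k j)] = omegaB (fun a b => B (G a) (G b)) k.
  by apply: eq_bigr => i _; rewrite !ffunE.
rewrite kw // -Fq // evalB_wedge_map; apply: eq_bigr => p _.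
by rewrite !GF.
Qed.

Lemma sympl_tuple_act (l q g : nat) (H : finZmodType) (wH : {ffun H * H -> int})
    (h : {ffun 'I_(g + g) -> H}) F :
  prime l -> l.-nat #|H| -> ~~ (l %| q)%N -> gsp_coset l q g F ->
  sympl_tuple wH h -> sympl_tuple (wH *+ q) (act h (F #|H|)).
Proof.
move=> pl lH lq [_ _ /(_ #|H|)/eqmx_modP HF] [hs hw].
have HN x := lgroup_exponent x pl lH.
have [F' HF'] := similitude_right_inverse pl lq HF; split.
  exact: (surj_act HN HF').
by move=> V B altB; rewrite (omegaB_act h altB HN HF) hw // raddfMn -pmulrn.
Qed.

Lemma sympl_tuple_exists (H : finZmodType) (wH : {ffun H * H -> int}) :
  exists g (h : {ffun 'I_(g + g) -> H}), sympl_tuple wH h.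
Proof.
(* One pair [(wH(p) p.1, p.2)] for each [p] in [H * H] produces [wH]; one pair [(y, 0)] for each [y]
   in [H] gives surjectivity and contributes nothing to the bivector. *)
pose T := ((H * H) + H)%type; pose g := #|{: T}|.
pose a (i : 'I_g) : H := match enum_val i with inl p => p.1 *~ wH p | inr y => y end.
pose b (i : 'I_g) : H := match enum_val i with inl p => p.2 | inr y => 0 end.
exists g, [ffun i => match fintype.split i with inl j => a j | inr j => b j end]; split.
  move=> y; exists (delta_mx (lshift g (enum_rank (inr y : T))) ord0).
  rewrite lin_delta ffunE; case: splitP => j /= Ej.
    have -> : j = enum_rank (inr y : T) by apply: val_inj.
    by rewrite /a enum_rankK.
  by have := ltn_ord (enum_rank (inr y : T)); rewrite Ej ltnNge leq_addr.
move=> V B altB; have [Bl Br B0] := altB.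
have -> : omegaB B [ffun i => match fintype.split i with inl j => a j | inr j => b j end] =
    \sum_(i < g) B (a i) (b i).
  apply: eq_bigr => i _; rewrite !ffunE -[lshift _ i]/(unsplit (inl i)).
  by rewrite -[rshift _ i]/(unsplit (inr i)) !unsplitK.
rewrite /a /b.
rewrite (reindex (enum_rank : T -> 'I_g)) /=; last first.
  by exists enum_val => i _; rewrite ?enum_rankK ?enum_valK.
under eq_bigr do rewrite enum_rankK.
rewrite big_sumType /= [X in _ + X]big1 ?addr0; last first.
  by move=> y _; apply: (addrI (B y 0)); rewrite -Br !addr0.
apply: eq_bigr => p _.
by have := additive_lin (fun _ : 'I_1 => p.1) (fun=> wH p) (Bl p.2); rewrite !big_ord1.
Qed.

Lemma sympl_tuple_mono (H : finZmodType) (wH : {ffun H * H -> int}) (g g' : nat) :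
  (g <= g')%N -> (exists h : {ffun 'I_(g + g) -> H}, sympl_tuple wH h) ->
  exists h : {ffun 'I_(g' + g') -> H}, sympl_tuple wH h.
Proof.
move=> gg [h [hs hw]].
have -> : g' = (g + (g' - g))%N by rewrite subnKC.
move: (g' - g)%N => d.
(* The zeros are placed at the end of each half, so that the old hyperbolic pairs remain pairs. *)
pose part (f : 'I_g -> H) (i : 'I_(g + d)) : H :=
  match fintype.split i with inl j => f j | inr _ => 0 end.
pose h' : {ffun 'I_((g + d) + (g + d)) -> H} :=
  [ffun i => match fintype.split i with
     inl j => part (fun k => h (lshift g k)) j | inr j => part (fun k => h (rshift g k)) j end].
have h'l i : h' (lshift _ i) = part (fun k => h (lshift g k)) i.
  by rewrite ffunE -[lshift _ i]/(unsplit (inl i)) unsplitK.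
have h'r i : h' (rshift _ i) = part (fun k => h (rshift g k)) i.
  by rewrite ffunE -[rshift _ i]/(unsplit (inr i)) unsplitK.
have pl f i : part f (lshift _ i) = f i.
  by rewrite /part -[lshift _ i]/(unsplit (inl i)) unsplitK.
have pr f i : part f (rshift _ i) = 0.
  by rewrite /part -[rshift _ i]/(unsplit (inr i)) unsplitK.
exists h'; split.
  move=> y; have [x ->] := hs y.
  exists (col_mx (col_mx (usubmx x) 0) (col_mx (dsubmx x) 0)).
  rewrite /lin [RHS]big_split_ord /= !big_split_ord /=.
  under [in RHS]eq_bigr do rewrite h'l pl !col_mxEu mxE.
  under [X in _ = _ + X + _]eq_bigr do rewrite h'l pr mul0rz.
  under [X in _ = _ + (X + _)]eq_bigr do rewrite h'r pl col_mxEd col_mxEu mxE.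
  under [X in _ = _ + (_ + X)]eq_bigr do rewrite h'r pr mul0rz.
  by rewrite !big1_eq !addr0.
move=> V B altB; have [Bl Br B0] := altB.
rewrite -hw // /omegaB big_split_ord /= [X in _ + X]big1 ?addr0.
  by apply: eq_bigr => i _; rewrite h'l h'r !pl.
by move=> i _; rewrite h'l h'r !pr B0.
Qed.

(** * Measurability and integration *)

Section Level.
Variables (n : nat).

Lemma cyl_measurable (k : nat) (M : 'M[int]_n) :
  measurable ([set F | F k = M] : set (MseqM n)).
Proof. by apply: sub_sigma_algebra; exists k, M. Qed.

(** There are countably many integer matrices, so a condition on one level defines a countable union
    of cylinders. *)
Lemma level_measurable (k : nat) (Q : 'M[int]_n -> Prop) :
  measurable ([set F | Q (F k)] : set (MseqM n)).
Proof.
have -> : ([set F | Q (F k)] : set (MseqM n)) =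
    \bigcup_M ([set F | Q M /\ F k = M] : set (MseqM n)).
  by apply/seteqP; split=> [F QF|F [M _ [/= QM ->]//]]; exists (F k).
apply: countable_bigcupT_measurable => [|M]; first exact: countableP.
have [QM|nQM] := pselect (Q M).
  rewrite (_ : [set F | _] = [set F | F k = M]); first exact: cyl_measurable.
  by apply/seteqP; split=> [F []|F].
rewrite (_ : [set F | _] = set0); first exact: measurable0.
by apply/seteqP; split=> [F []|F].
Qed.

Lemma zl_mx_measurable (l : nat) : measurable ([set F | zl_mx l F] : set (MseqM n)).
Proof.
have -> : ([set F | zl_mx l F] : set (MseqM n)) = \bigcap_k
    \bigcup_M
      (([set F | F k.+1 = M] : set (MseqM n)) `&` [set F | F k = map_mx (red l k) M]).
  apply/seteqP; split=> [F zF k _|F zF k].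
    by exists (F k.+1) => //; split=> //=; exact: zF.
  by have [M _ [/= -> ->]] := zF k I.
apply: bigcapT_measurable => k.
apply: countable_bigcupT_measurable => [|M]; first exact: countableP.
by apply: measurableI; exact: cyl_measurable.
Qed.

End Level.

Lemma gsp_coset_measurable (l q g : nat) :
  measurable (gsp_coset l q g : set (MseqM (g + g))).
Proof.
have -> : (gsp_coset l q g : set (MseqM (g + g))) =
   ([set F | zl_mx l F] : set (MseqM (g + g))) `&`
   (([set F | ~~ (l%:Z %| \det (F 0%N))%Z] : set (MseqM (g + g))) `&`
   \bigcap_k ([set F | map_mx (red l k) (F k *m Jmx g *m (F k)^T) =
      map_mx (red l k) (q%:Z *: Jmx g)] : set (MseqM (g + g)))).
  apply/seteqP; split=> [F [zF dF JF]|F [zF [dF JF]]].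
    by split=> //; split=> // k _; exact: JF.
  by split=> // k; exact: JF.
apply: measurableI; first exact: zl_mx_measurable.
apply: measurableI; first exact: (level_measurable 0 (fun M => ~~ (l%:Z %| \det M)%Z)).
apply: bigcapT_measurable => k.
exact: (level_measurable k (fun M => map_mx (red l k) (M *m Jmx g *m M^T) =
  map_mx (red l k) (q%:Z *: Jmx g))).
Qed.


Lemma integral_count d (T : measurableType d) (R : realType)
    (mu : {measure set T -> \bar R}) (I : finType) (A : I -> T -> Prop) :
  (forall i, measurable [set x | A i x]) ->
  (\int[mu]_x ((#|[set i | `[< A i x >]]|%:R : R)%:E) = \sum_i mu [set x | A i x])%E.
Proof.
move=> mA.
transitivity (\int[mu]_x \sum_(i <- index_enum I) (\1_([set x | A i x]) x : R)%:E)%E.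
  apply: eq_integral => x _; rewrite sumEFin; congr (_%:E).
  rewrite -sum1_card natr_sum big_mkcond /=; apply: eq_bigr => i _.
  rewrite indicE; case: (asboolP (A i x)) => H.
    by rewrite !mem_set //; apply/asboolP.
  by rewrite !memNset //= => /asboolP.
rewrite ge0_integral_sum //.
- by apply: eq_bigr => i _; rewrite integral_indic // setIT.
- move=> i; apply/measurable_realfun.measurable_EFinP.
  exact: measurable_realfun.measurable_indic.
Qed.

(** Associativity [(h S) F = h (S F)] turns a change of tuple into a left translation by [S]; the
    reductions do not alter the action on [H] at level [#|H|]. *)
Lemma haar_translate (l q g : nat) (H : finZmodType) (R : realType)
    (mu : probability (MseqM (g + g)) R) (S : 'M[int]_(g + g))
    (h k : {ffun 'I_(g + g) -> H}) :
  prime l -> l.-nat #|H| -> haar_gsp l q g mu -> symp S ->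
  (mu [set F | act (act h S) (F #|H|) = k] = mu [set F | act h (F #|H|) = k])%E.
Proof.
move=> pl lH [_ muS] HS.
rewrite -(muS _ (gsp_coset_symp pl HS) [set F | act h (F #|H|) = k]); last first.
  exact: (level_measurable #|H| (fun M => act h M = k)).
have HN x := lgroup_exponent x pl lH.
suff E F : act h (lvl_mul l (fun k => map_mx (red l k) S) F #|H|) = act (act h S) (F #|H|).
  by congr (mu _); apply/seteqP; split=> F /=; rewrite E.
rewrite act_mul /lvl_mul (act_eqmx h HN (eqmx_mod_red _ _ _)).
apply: act_eqmx HN _; apply: eqmx_mod_mul; first exact: eqmx_mod_red.
exact: eqmx_mod_refl.
Qed.

(** * The expected number of surjections *)

Theorem theorem3p1 (l : nat) (H : finZmodType) (wH : {ffun H * H -> int}) :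
  prime l -> l.-nat #|H| ->
  exists g0 : int,
    forall (q : nat) (P : nat -> {poly int}) (FH : {additive H -> H}),
      prime_power q -> ~~ (l %| q)%N ->
      zl_poly l P -> (forall k, P k \is monic) -> ~~ ((l%:Z %| (P 0%N)`_0)%Z) ->
      poly_kills l P FH ->
      wedge_eq (wedge_map FH wH) (wH *+ q) ->
      forall (g : nat) (R : realType) (mu : probability (MseqM (g + g)) R),
        haar_gsp l q g mu ->
        (\int[mu]_F ((count_surj l g P FH wH F)%:R : R)%:E
           = if ((g%:Z <= g0)%R) then 0 else 1)%E.
Proof.
move=> pl lH.
have exg : exists g, `[< exists h : {ffun 'I_(g + g) -> H}, sympl_tuple wH h >].
  by have [g Hg] := sympl_tuple_exists wH; exists g; apply/asboolP.
case: (ex_minnP exg) => m /asboolP m_ex m_min.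
(* With [m] the least [g] admitting a symplectic tuple, [g <= m - 1] means that there is none. The
   bound is an integer because [m] may be 0. *)
exists (m%:Z - 1) => q P FH _ lq zP _ lP0 PFH wFH g R mu Hmu.
have FHi := killed_by_unit_poly_inj pl lH zP lP0 PFH.
have mA (h : {ffun 'I_(g + g) -> H}) :
    measurable ([set F | good_tuple l g P FH wH F h] : set (MseqM (g + g))).
  rewrite (_ : [set F | _] =
      [set F | sympl_tuple wH h /\ act h (F #|H|) = [ffun j => FH (h j)]]).
    exact: (level_measurable #|H| (fun M => sympl_tuple wH h /\ act h M = _)).
  by apply/seteqP; split=> F /=; rewrite good_tupleP.
rewrite (integral_count (A := fun h F => good_tuple l g P FH wH F h) mu mA).
case: ifPn => gm.
  rewrite big1 // => h _.
  rewrite (_ : [set F | _] = set0) ?measure0 //.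
  apply/seteqP; split=> F //= /(good_tupleP _ _ _ pl lH PFH)[Xh _].
  have := m_min g; have -> : (m <= g)%N = false by lia.
  by move=> mg; suff : false by []; apply: mg; apply/asboolP; exists h.
have {gm} gm : (m <= g)%N by lia.
have [h0 Xh0] := sympl_tuple_mono gm m_ex.
(* By transitivity and invariance [h F] may be replaced by [h0 F], with the same [h0] for every
   [h]. *)
pose C (h : {ffun 'I_(g + g) -> H}) (F : Mseq (g + g)) :=
  sympl_tuple wH h /\ act h0 (F #|H|) = [ffun j => FH (h j)].
have mC h : measurable ([set F | C h F] : set (MseqM (g + g))).
  exact: (level_measurable #|H| (fun M => sympl_tuple wH h /\ act h0 M = _)).
transitivity (\sum_h mu [set F | C h F]).
  apply: eq_bigr => h _.
  have [Xh|nXh] := pselect (sympl_tuple wH h); last first.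
    congr (mu _); apply/seteqP; split=> F /=; last by case.
    by move=> /(good_tupleP _ _ _ pl lH PFH)[].
  have [S [HS hS]] : exists S, symp S /\ h = act h0 S.
    apply: sp_transitive pl lH Xh0.1 Xh.1 _ => V B altB.
    by rewrite Xh0.2 // Xh.2.
  rewrite (_ : [set F | C h F] =
    [set F | act h0 (F #|H|) = [ffun j => FH (h j)]]); last first.
    by apply/seteqP; split=> F //= [].
  rewrite -(haar_translate _ _ pl lH Hmu HS) -hS.
  congr (mu _); apply/seteqP; split=> F /=.
    by move=> /(good_tupleP _ _ _ pl lH PFH)[].
  by move=> hF; apply/(good_tupleP _ _ _ pl lH PFH).
rewrite -(integral_count mu mC).
pose G := [set F : MseqM (g + g) | exists h, C h F].
have mG : measurable G.
  exact: (level_measurable #|H| (fun M =>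
    exists h, sympl_tuple wH h /\ act h0 M = [ffun j => FH (h j)])).
(* Injectivity of [FH] allows at most one [h] with [FH h = h0 F], so the count is the indicator of
   [G]. *)
transitivity (\int[mu]_F (\1_G F : R)%:E)%E.
  apply: eq_integral => F _; congr (_%:E); rewrite indicE.
  have [[h Ch]|nG] := pselect (exists h, C h F).
    rewrite mem_set; last by exists h.
    rewrite (_ : #|_| = 1%N) //; rewrite -(card1 h); apply: eq_card => h'.
    apply/idP/eqP => [/set_mem/asboolP[_ Eh']|->]; last first.
      by rewrite mem_set //=; apply/asboolP.
    apply/ffunP => j; apply: (FHi); move: Eh'; rewrite Ch.2 => /ffunP/(_ j).
    by rewrite !ffunE.
  rewrite memNset // (_ : #|_| = 0%N) //.
  apply: eq_card0 => h; apply/negbTE/negP => /set_mem/asboolP Ch.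
  by apply: nG; exists h.
rewrite integral_indic // setIT; apply/eqP; rewrite eq_le probability_le1 //=.
(* The coset has mass 1 and lies in [G]: [h0 F] carries [omega] to [q wH], hence equals [FH h] for
   some symplectic tuple [h]. *)
have [<- _] := Hmu; apply: le_measure; rewrite ?inE //.
  exact: gsp_coset_measurable.
move=> F HF.
have [h Xh Eh] := sympl_tuple_preimage FHi wFH (sympl_tuple_act pl lH lq HF Xh0).
by exists h.
Qed.
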